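(* The following are equivalent: (1) there is a polynomial $P$ such that for every graph $G$ and every list assignment $\mathcal L:V(G)\to\mathcal P(\{A_1,A_2,A_3,A_4\})$, there is a 2-list covering for the stubborn problem on $(G,\mathcal L)$ of size at most $P(|V(G)|)$; (2) there is a polynomial $P$ such that for every $n$ and every edge-coloring $f:E(K_n)\to\{A,B,C\}$, there is a 2-list covering for 3-CCP on $(K_n,f)$ of size at most $P(n)$; (3) there is a polynomial $P$ such that every graph on $n$ vertices has a CS-separator of size at most $P(n)$.
   Context: Stubborn problem: an instance is a graph $G=(V,E)$ with a list assignment $\mathcal L:V\to\mathcal P(\{A_1,A_2,A_3,A_4\})$; a solution is a partition of $V$ into (possibly empty) sets $A_1,A_2,A_3,A_4$ such that $A_4$ is a clique, $A_1$ and $A_2$ are stable sets, there is no edge between $A_1$ and $A_3$, and each vertex $v$ lies in a set $A_i$ with $A_i\in\mathcal L(v)$. A solution is maximal if no $v\in A_1$ satisfies $A_3\in\mathcal L(v)$. 3-CCP: given an edge-coloring $f$ of $K_n$ with colors $\{A,B,C\}$, a solution is a vertex coloring $c$ with colors $\{A,B,C\}$ such that no edge $uv$ has $f(uv)=c(u)=c(v)$. A 2-list assignment assigns to each vertex a set of at most two colors (resp. of at most two of $A_1,\dots,A_4$); it is compatible with a solution if each vertex's color (resp. part) belongs to its set. A 2-list covering for 3-CCP on $(K_n,f)$ is a set of 2-list assignments such that every solution is compatible with at least one of them; a 2-list covering for the stubborn problem on $(G,\mathcal L)$ is a set of 2-list assignments such that every maximal solution is compatible with at least one of them. A cut of $G=(V,E)$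 is a pair $(U,W)$ with $U\cup W=V$, $U\cap W=\emptyset$; it separates a clique $K$ and a stable set $S$ if $K\subseteq U$, $S\subseteq W$; a CS-separator is a family of cuts separating every clique from every stable set disjoint from it. *)

(* Defs.v *)
From HB Require Import structures.
From mathcomp Require Import all_boot all_order all_algebra.

Set Implicit Arguments.
Unset Strict Implicit.
Unset Printing Implicit Defensive.

Record sgraph := SGraph {
  vertex :> finType;
  edge : rel vertex;
  edge_sym : symmetric edge;
  edge_irr : irreflexive edge }.

Definition clique (G : sgraph) (K : {set G}) : Prop :=
  {in K &, forall u v, u != v -> edge u v}.

Definition stable (G : sgraph) (S : {set G}) : Prop :=
  {in S &, forall u v, ~~ edge u v}.

Definition no_edge_between (G : sgraph) (X Y : {set G}) : Prop :=
  {in X & Y, forall u v, ~~ edge u v}.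

Inductive part := A1 | A2 | A3 | A4.

Definition ord_of_part (i : part) : 'I_4 :=
  inord match i with A1 => 0 | A2 => 1 | A3 => 2 | A4 => 3 end.
Definition part_of_ord (i : 'I_4) : part :=
  match val i with 0 => A1 | 1 => A2 | 2 => A3 | _ => A4 end.
Lemma ord_of_partK : cancel ord_of_part part_of_ord.
Proof. by case; rewrite /part_of_ord /= inordK. Qed.
HB.instance Definition _ := Finite.copy part (can_type ord_of_partK).

Inductive color := ColA | ColB | ColC.

Definition ord_of_color (i : color) : 'I_3 :=
  inord match i with ColA => 0 | ColB => 1 | ColC => 2 end.
Definition color_of_ord (i : 'I_3) : color :=
  match val i with 0 => ColA | 1 => ColB | _ => ColC end.
Lemma ord_of_colorK : cancel ord_of_color color_of_ord.
Proof. by case; rewrite /color_of_ord /= inordK. Qed.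
HB.instance Definition _ := Finite.copy color (can_type ord_of_colorK).

Section TwoListCovering.
Variables T C : finType.
Implicit Types (l : {ffun T -> {set C}}) (s : {ffun T -> C}).

Definition two_list_assignment l : Prop := forall v, #|l v| <= 2.

Definition compatible l s : Prop := forall v, s v \in l v.

(* The covering condition common to both problems; [sol] is the set of
   solutions that have to be covered. *)
Definition two_list_covering (sol : {ffun T -> C} -> Prop)
    (F : {set {ffun T -> {set C}}}) : Prop :=
  (forall l, l \in F -> two_list_assignment l) /\
  (forall s, sol s -> exists2 l, l \in F & compatible l s).

End TwoListCovering.

(* A partition of the vertices into possibly empty sets A1, ..., A4 is encoded
   by the function sending each vertex to the part that contains it. *)
Definition part_class (G : sgraph) (s : {ffun G -> part}) (i : part) : {set G} :=
  [set v | s v == i].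

Definition stubborn_solution (G : sgraph) (L : G -> {set part})
    (s : {ffun G -> part}) : Prop :=
  [/\ clique (part_class s A4),
      stable (part_class s A1),
      stable (part_class s A2),
      no_edge_between (part_class s A1) (part_class s A3)
    & forall v, s v \in L v].

Definition maximal_stubborn_solution (G : sgraph) (L : G -> {set part})
    (s : {ffun G -> part}) : Prop :=
  stubborn_solution L s /\
  ~ exists2 v, v \in part_class s A1 & A3 \in L v.

(* An edge-coloring of the complete graph on ['I_n] is a symmetric function;
   its values on the diagonal are irrelevant. *)
Definition edge_coloring (n : nat) (f : 'I_n -> 'I_n -> color) : Prop :=
  forall u v, f u v = f v u.

Definition ccp_solution (n : nat) (f : 'I_n -> 'I_n -> color)
    (c : {ffun 'I_n -> color}) : Prop :=
  ~ exists u v, [/\ u != v, f u v = c u & c u = c v].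

Definition is_cut (T : finType) (c : {set T} * {set T}) : Prop :=
  c.1 :|: c.2 = [set: T] /\ c.1 :&: c.2 = set0.

Definition separates (T : finType) (c : {set T} * {set T}) (K S : {set T}) : Prop :=
  K \subset c.1 /\ S \subset c.2.

Definition CS_separator (G : sgraph) (F : {set {set G} * {set G}}) : Prop :=
  (forall c, c \in F -> is_cut c) /\
  (forall K S : {set G}, clique K -> stable S -> [disjoint K & S] ->
     exists2 c, c \in F & separates c K S).

(* Main.v *)
Require Import Defs.
From mathcomp Require Import all_boot all_order all_algebra.

(** Everything goes through CS-separators.

    From separators to the stubborn problem: one cut separates A4 from A1 and
    another one separates A4 from A2.  They leave two possible parts to each vertex,
    except on the side of A1 and A2 of both cuts, where A1, A2 and A3 remain; there
    maximality excludes A1 if A3 is in the list of the vertex.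

    From separators to 3-CCP: fix one solution c0, if any.  The class of color i
    of c0 has no edge of color i, so inside it the other two classes of any
    solution form a clique and a stable set of the graph of the edges of one
    color; a cut separating them gives lists of size two.

    Conversely, a clique K, a stable set S and the remaining vertices are the
    classes of a solution of a suitable instance.  A compatible 2-list assignment
    tells K from S except on the vertices that must belong to K or S.  They induce
    a split graph, and two partitions of a split graph into a clique and a stable
    set differ by moving at most one vertex each way, so there are at most
    (n + 1)^2 of them. *)

Set Implicit Arguments.
Unset Strict Implicit.
Unset Printing Implicit Defensive.

Import Order.TTheory GRing.Theory Num.Theory.

(** * Basic facts on cliques, stable sets and cuts *)

Lemma cliqueP (G : sgraph) (K : {set G}) :
  reflect (clique K)
    [forall u in K, forall v in K, (u != v) ==> edge u v].
Proof.
apply: (iffP forall_inP) => [cK u v uK vK | cK u uK].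
  by move/forall_inP: (cK u uK) => /(_ v vK) /implyP.
by apply/forall_inP => v vK; apply/implyP; apply: cK.
Qed.

Lemma stableP (G : sgraph) (S : {set G}) :
  reflect (stable S) [forall u in S, forall v in S, ~~ edge u v].
Proof.
apply: (iffP forall_inP) => [sS u v uS vS | sS u uS].
  by move/forall_inP: (sS u uS) => /(_ v vS).
by apply/forall_inP => v vS; apply: sS.
Qed.

Lemma ccp_solutionP (n : nat) (f : 'I_n -> 'I_n -> color) (c : {ffun 'I_n -> color}) :
  reflect (ccp_solution f c)
    [forall u, forall v, (u != v) ==> (f u v == c u) ==> (c u != c v)].
Proof.
apply: (iffP forallP) => [sc [u [v [uv fuv cuv]]] | sc u].
  by move/forallP: (sc u) => /(_ v); rewrite uv fuv cuv eqxx.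
apply/forallP => v; apply/implyP => uv; apply/implyP => /eqP fuv.
by apply/eqP => cuv; apply: sc; exists u, v.
Qed.

Lemma clique_sub (G : sgraph) (K K' : {set G}) :
  K' \subset K -> clique K -> clique K'.
Proof. by move=> /subsetP sub cK u v uK vK; apply: cK; apply: sub. Qed.

Lemma stable_sub (G : sgraph) (S S' : {set G}) :
  S' \subset S -> stable S -> stable S'.
Proof. by move=> /subsetP sub sS u v uS vS; apply: sS; apply: sub. Qed.

(** Two distinct common vertices would be both adjacent and non-adjacent. Coding the intersection by
    an option leaves [#|G|.+1] candidates for it. *)
Lemma clique_stable_meet (G : sgraph) (K S : {set G}) :
  clique K -> stable S -> exists o : option G, K :&: S = [set v | Some v == o].
Proof.
move=> cK sS; case: (set_0Vmem (K :&: S)) => [-> | [x]].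
  by exists None; apply/setP => v; rewrite !inE.
rewrite inE => /andP [xK xS]; exists (Some x); apply/setP => v; rewrite !inE.
apply/andP/eqP => [[vK vS] | [->] //].
congr Some; apply/eqP; apply: contraT => vx.
by move: (sS _ _ vS xS); rewrite cK.
Qed.

Lemma cut_setC (T : finType) (D : {set T}) : is_cut (D, ~: D).
Proof. by rewrite /is_cut /= setUCr setICr. Qed.

Lemma cut_disjoint (T : finType) (c : {set T} * {set T}) v :
  is_cut c -> v \in c.1 -> v \in c.2 -> False.
Proof. by move=> [_ c0] v1 v2; move/setP: c0 => /(_ v); rewrite !inE v1 v2. Qed.

(** * From 2-list coverings to CS-separators *)

(* [p] records partial knowledge of a clique [K] and a stable set [S]: the
   vertices of [p.1] are not in [S], those of [p.2] are not in [K], and all the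
   others are in [K] or [S]. *)
Definition locates (T : finType) (p : {set T} * {set T}) (K S : {set T}) : Prop :=
  [/\ [disjoint S & p.1], [disjoint K & p.2] & ~: (p.1 :|: p.2) \subset K :|: S].

Lemma separator_of_location (G : sgraph) (p : {set G} * {set G}) :
  exists F : {set {set G} * {set G}},
    [/\ forall c, c \in F -> is_cut c,
        forall K S : {set G}, clique K -> stable S -> [disjoint K & S] ->
          locates p K S -> exists2 c, c \in F & separates c K S
      & #|F| <= #|G|.+1 ^ 2].
Proof.
set X := ~: (p.1 :|: p.2).
have [/existsP [K0 /andP [/cliqueP cK0 /stableP sS0]] | /negP noK0] :=
  boolP [exists K0 : {set G},
    [forall u in K0, forall v in K0, (u != v) ==> edge u v] &&
    [forall u in X :\: K0, forall v in X :\: K0, ~~ edge u v]]; last first.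
  (* Here no pair is located by [p]: with such a pair, [K :&: X] would be a clique whose complement
     in [X] lies in [S]. *)
  exists set0; split; [by move=> c; rewrite inE | | by rewrite cards0].
  move=> K S cK sS KS [_ _ subX].
  case: noK0; apply/existsP; exists (K :&: X); apply/andP; split.
    by apply/cliqueP; apply: clique_sub cK; apply: subsetIl.
  apply/stableP; apply: stable_sub sS; apply/subsetP => v.
  rewrite in_setD in_setI => /andP [vnK vX]; move/subsetP: subX => /(_ v vX).
  by rewrite vX andbT in vnK; rewrite inE (negPf vnK).
(* [o.1] guesses the intersection of [K0] and [S], and [o.2] that of [K] and [X :\: K0]; both have
   at most one vertex. Outside [X], the clique can only meet [p.1 :\: p.2]. *)
pose D (o : option G * option G) : {set G} := (p.1 :\: p.2) :|:
  ((K0 :\: [set v | Some v == o.1]) :&: X :|: [set v | Some v == o.2]).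
exists [set (D o, ~: D o) | o in [set: option G * option G]]; split.
- by move=> c /imsetP [o _ ->]; apply: cut_setC.
- move=> K S cK sS KS [Sp1 Kp2 subX].
  have [o1 e1] := clique_stable_meet cK0 sS.
  have [o2 e2] := clique_stable_meet cK sS0.
  exists (D (o1, o2), ~: D (o1, o2)); first by apply: imset_f.
  rewrite /D /= -e1 -e2; split; apply/subsetP => v /=.
    move=> vK; have vnp2 := disjointFr Kp2 vK; have vnS := disjointFr KS vK.
    by rewrite !inE vK vnp2 vnS /=; case: (v \in p.1); case: (v \in K0).
  move=> vS; have vnp1 := disjointFr Sp1 vS; have vnK := disjointFl KS vS.
  by rewrite !inE vS vnp1 vnK /= andbT andNb andbF.
- by rewrite -mulnn -card_option -card_prod -cardsT leq_imset_card.
Qed.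

Lemma separator_of_locations (G : sgraph) (I : finType) (A : {set I})
    (p : I -> {set G} * {set G}) :
  (forall K S : {set G}, clique K -> stable S -> [disjoint K & S] ->
     exists2 i, i \in A & locates (p i) K S) ->
  exists F : {set {set G} * {set G}},
    CS_separator F /\ #|F| <= #|A| * #|G|.+1 ^ 2.
Proof.
move=> locA.
have [F FP] := fin_all_exists (fun i => separator_of_location (p i)).
exists (\bigcup_(i in A) F i); split; first split.
- by move=> c /bigcupP [i _]; case: (FP i) => cutF _ _; apply: cutF.
- move=> K S cK sS KS; have [i iA locp] := locA K S cK sS KS.
  have [_ sepF _] := FP i; have [c cF csep] := sepF K S cK sS KS locp.
  by exists c => //; apply/bigcupP; exists i.
- rewrite -sum_nat_const.
  apply: leq_trans (_ : \sum_(i in A) #|F i| <= _); last first.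
    by apply: leq_sum => i _; case: (FP i).
  elim/big_rec2: _ => [|i m B _ le]; first by rewrite cards0.
  by apply: leq_trans (leq_card_setU _ _) _; rewrite leq_add2l.
Qed.

(* [a] and [b] are the classes standing for the clique and for the stable set. *)
Lemma separator_of_lists (G : sgraph) (T C : finType) (h : G -> T) (a b d : C)
    (F : {set {ffun T -> {set C}}}) :
  a != b -> a != d -> b != d ->
  (forall l, l \in F -> two_list_assignment l) ->
  (forall K S : {set G}, clique K -> stable S -> [disjoint K & S] ->
     exists2 l, l \in F & forall v,
       (if v \in K then a else if v \in S then b else d) \in l (h v)) ->
  exists F' : {set {set G} * {set G}},
    CS_separator F' /\ #|F'| <= #|F| * #|G|.+1 ^ 2.
Proof.
move=> ab ad bd two cov.
apply: (@separator_of_locations _ _ F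
  (fun l => ([set v | b \notin l (h v)], [set v | a \notin l (h v)]))).
move=> K S cK sS KS; have [l lF lP] := cov K S cK sS KS.
exists l => //; split=> /=.
- rewrite disjoint_subset; apply/subsetP => v vS; rewrite !inE negbK.
  by move: (lP v); rewrite (disjointFl KS vS) vS.
- rewrite disjoint_subset; apply/subsetP => v vK; rewrite !inE negbK.
  by move: (lP v); rewrite vK.
(* A list of size two containing both [a] and [b] has no room for [d], so such a vertex lies in [K]
   or [S]. *)
- apply/subsetP => v; rewrite !inE negb_or !negbK => /andP [bl al].
  move: (lP v); case: (v \in K) => //; case: (v \in S) => // dl.
  have : [set a; b; d] \subset l (h v).
    by apply/subsetP => x; rewrite !inE -orbA => /or3P [] /eqP ->.
  move/subset_leq_card/leq_trans => /(_ _ (two l lF (h v))).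
  by rewrite setUC cardsU1 cards2 !inE ab negb_or ![d == _]eq_sym ad bd.
Qed.

(** Leaving [A1] out of every list makes it empty, so every solution is maximal; [K], [S] and the
    rest become [A4], [A2] and [A3]. *)
Lemma separator_of_stubborn (G : sgraph) (F : {set {ffun G -> {set part}}}) :
  two_list_covering
    (maximal_stubborn_solution (fun _ : G => [set A2; A3; A4])) F ->
  exists F' : {set {set G} * {set G}},
    CS_separator F' /\ #|F'| <= #|F| * #|G|.+1 ^ 2.
Proof.
move=> [two cov].
apply: (@separator_of_lists G G _ id A4 A2 A3) two _; try by apply/eqP.
move=> K S cK sS KS.
pose s := [ffun v => if v \in K then A4 else if v \in S then A2 else A3].
have no1 v : v \notin part_class s A1.
  by rewrite inE ffunE; case: ifP => _; [|case: ifP => _]; apply/eqP.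
have [|l lF lP] := cov s.
  split; last by case=> v; rewrite (negPf (no1 v)).
  split.
  - apply: clique_sub cK; apply/subsetP => v; rewrite inE ffunE.
    by case: ifP => // _; case: ifP => _ /eqP.
  - by move=> u v; rewrite (negPf (no1 u)).
  - apply: stable_sub sS; apply/subsetP => v; rewrite inE ffunE.
    by case: ifP => _; [move/eqP | case: ifP => // _ /eqP].
  - by move=> u v; rewrite (negPf (no1 u)).
  - by move=> v; rewrite ffunE !inE; case: ifP => _; [|case: ifP => _];
      rewrite eqxx ?orbT.
by exists l => // v; move: (lP v); rewrite ffunE.
Qed.

(** Edges get color A and non-edges color B, so B on [K], A on [S] and C, the color of no edge, on
    the rest is a solution. *)
Lemma separator_of_ccp (G : sgraph) (F : {set {ffun 'I_#|G| -> {set color}}}) :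
  two_list_covering
    (ccp_solution (fun u v => if edge (enum_val u : G) (enum_val v)
                              then ColA else ColB)) F ->
  exists F' : {set {set G} * {set G}},
    CS_separator F' /\ #|F'| <= #|F| * #|G|.+1 ^ 2.
Proof.
move=> [two cov].
apply: (@separator_of_lists G _ _ enum_rank ColB ColA ColC) two _;
  try by apply/eqP.
move=> K S cK sS KS.
pose c (v : G) := if v \in K then ColB else if v \in S then ColA else ColC.
have [|l lF lP] := cov [ffun i => c (enum_val i)].
  case=> i [j]; rewrite !ffunE => -[ij].
  have {ij}: enum_val i != enum_val j :> G by rewrite (inj_eq enum_val_inj).
  move: (enum_val i) (enum_val j) => u v uv; rewrite /c.
  case: (boolP (u \in K)) => uK; first case: (boolP (v \in K)) => vK.
  - by rewrite (cK _ _ uK vK uv).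
  - by case: (v \in S).
  - case: (boolP (u \in S)) => uS; last by case: ifP.
    case: (v \in K) => //; case: (boolP (v \in S)) => // vS.
    by rewrite (negPf (sS _ _ uS vS)).
by exists l => // v; move: (lP (enum_rank v)); rewrite ffunE enum_rankK.
Qed.

(** * From CS-separators to the stubborn problem *)

Lemma stubborn_of_separator (G : sgraph) (L : G -> {set part})
    (F : {set {set G} * {set G}}) :
  CS_separator F ->
  exists F' : {set {ffun G -> {set part}}},
    two_list_covering (maximal_stubborn_solution L) F' /\ #|F'| <= #|F| ^ 2.
Proof.
move=> [cutF sepF].
(* The clique side of the first cut excludes [A1], that of the second excludes [A2], and the other
   side of either excludes [A4]. In the last case, if [A3] is not in [L v], then [L v] itself
   excludes [A3]. *)
pose lst (c : ({set G} * {set G}) * ({set G} * {set G})) :=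
  [ffun v => if v \in c.1.1 then
               if v \in c.2.1 then [set A3; A4] else [set A2; A3]
             else if v \in c.2.1 then [set A1; A3]
             else if A3 \in L v then [set A2; A3] else [set A1; A2]].
exists [set lst c | c in setX F F]; split; last first.
  by apply: leq_trans (leq_imset_card _ _) _; rewrite cardsX mulnn.
split=> [l /imsetP [c _ ->] v | s [[cl4 st1 st2 _ inL] maxs]].
  by rewrite ffunE; do !case: ifP => _; rewrite cards2; case: eqP.
have dis i : i != A4 -> [disjoint part_class s A4 & part_class s i].
  move=> i4; rewrite disjoint_subset; apply/subsetP => v.
  by rewrite !inE => /eqP ->; rewrite eq_sym.
have [c1 c1F [/subsetP K1 /subsetP S1]] := sepF _ _ cl4 st1 (dis A1 ltac:(by apply/eqP)).
have [c2 c2F [/subsetP K2 /subsetP S2]] := sepF _ _ cl4 st2 (dis A2 ltac:(by apply/eqP)).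
exists (lst (c1, c2)); first by apply: imset_f; rewrite inE /= c1F.
move=> v; rewrite ffunE /=.
have := inL v; have := K1 v; have := K2 v; have := S1 v; have := S2 v.
have : s v = A1 -> A3 \in L v -> False.
  by move=> sv A3L; apply: maxs; exists v; rewrite ?inE ?sv.
have := @cut_disjoint _ _ v (cutF _ c1F); have := @cut_disjoint _ _ v (cutF _ c2F).
rewrite !inE; case: (s v) => d2 d1 mx s2 s1 k2 k1 sL.
- have v12 := s1 (eqxx _); case: (boolP (v \in c1.1)) => [/d1 -/(_ v12) //|_].
  by case: ifP => _; [|case: ifP => [/(mx erefl) //|_]]; rewrite !inE eqxx.
- have v22 := s2 (eqxx _); case: (boolP (v \in c2.1)) => [/d2 -/(_ v22) //|_].
  by do !case: ifP => _; rewrite !inE eqxx ?orbT.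
- by rewrite sL; do !case: ifP => _; rewrite !inE eqxx ?orbT.
- by rewrite k1 ?k2 ?eqxx // !inE eqxx orbT.
Qed.

(** * From CS-separators to 3-CCP *)

(** A cyclic order on the colors, so that the three classes of [c0] are treated uniformly. *)
Definition next_color (i : color) : color :=
  match i with ColA => ColB | ColB => ColC | ColC => ColA end.

Lemma next_color_neq (i : color) : next_color i != i.
Proof. by case: i; apply/eqP. Qed.

Lemma color_cases (i j : color) :
  [\/ j = i, j = next_color i | j = next_color (next_color i)].
Proof.
by case: i; case: j; (try by constructor 1); (try by constructor 2); constructor 3.
Qed.

Section ColorGraph.
Variables (n : nat) (f : 'I_n -> 'I_n -> color).
Hypothesis fsym : edge_coloring f.

(** The diagonal is removed because [f u u] is arbitrary. *)
Definition color_edge (i : color) : rel 'I_n := [rel u v | (u != v) && (f u v == i)].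

Lemma color_edge_sym i : symmetric (color_edge i).
Proof. by move=> u v; rewrite /color_edge /= eq_sym fsym. Qed.

Lemma color_edge_irr i : irreflexive (color_edge i).
Proof. by move=> u; rewrite /color_edge /= eqxx. Qed.

Definition color_graph (i : color) : sgraph :=
  SGraph (color_edge_sym i) (@color_edge_irr i).

End ColorGraph.

Lemma ccp_of_separator (n : nat) (f : 'I_n -> 'I_n -> color)
    (fsym : edge_coloring f) (m : nat) :
  (forall i, exists F : {set {set color_graph fsym i} * {set color_graph fsym i}},
     CS_separator F /\ #|F| <= m) ->
  exists F : {set {ffun 'I_n -> {set color}}},
    two_list_covering (ccp_solution f) F /\ #|F| <= m ^ #|{: color}|.
Proof.
move=> sep.
have [/existsP [c0 /ccp_solutionP sc0] | /negP nosol] :=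
  boolP [exists c : {ffun 'I_n -> color},
    [forall u, forall v, (u != v) ==> (f u v == c u) ==> (c u != c v)]]; last first.
  (* Without solutions, the empty family is a covering. *)
  exists set0; rewrite cards0; split=> //; split=> [l|c sc]; first by rewrite inE.
  by case: nosol; apply/existsP; exists c; apply/ccp_solutionP.
have [F FP] : exists F : color -> {set {set 'I_n} * {set 'I_n}},
    forall i, @CS_separator (color_graph fsym (next_color i)) (F i) /\ #|F i| <= m.
  exact: (fin_all_exists (fun i => sep (next_color i))).
(* [g] chooses one cut for each class of [c0]. In class [i], the clique side excludes [next_color i]
   and the other side excludes the third color; choosing the cuts independently gives the exponent
   [#|{: color}|]. *)
pose lst (g : {ffun color -> {set 'I_n} * {set 'I_n}}) : {ffun 'I_n -> {set color}} :=
  [ffun v => let i := c0 v in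
    if v \in (g i).1 then [set i; next_color (next_color i)]
    else [set i; next_color i]].
exists [set lst g | g in family F]; split; last first.
  apply: leq_trans (leq_imset_card _ _) _; rewrite card_family /image_mem cardE.
  elim: (enum _) => //= i e le; rewrite expnS leq_mul //; by case: (FP i).
split=> [l /imsetP [g _ ->] v | s ss].
  by rewrite ffunE /=; case: ifP => _; rewrite cards2; case: eqP.
pose cls i j := [set v | (c0 v == i) && (s v == j)].
have sepc i : exists c, c \in F i /\
    separates c (cls i (next_color (next_color i))) (cls i (next_color i)).
  have [[_ sepF] _] := FP i.
  have [|||c cF csep] := sepF (cls i (next_color (next_color i))) (cls i (next_color i)).
  - move=> u v; rewrite !inE => /andP [/eqP u0 /eqP us] /andP [/eqP v0 /eqP vs] uv.
    rewrite /= /color_edge /= uv /=.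
    (* Color [i] is excluded by [c0] and the third color by [s], so the edge has color
       [next_color i]. *)
    case: (color_cases i (f u v)) => fuv.
    + by case: sc0; exists u, v; rewrite u0 v0.
    + by rewrite fuv.
    + by case: ss; exists u, v; rewrite us vs.
  - move=> u v; rewrite !inE => /andP [_ /eqP us] /andP [_ /eqP vs].
    by rewrite /= /color_edge /= negb_and; case: eqP => //= /eqP uv; apply/eqP => fuv;
      case: ss; exists u, v; rewrite us vs.
  - rewrite disjoint_subset; apply/subsetP => v; rewrite !inE => /andP [_ /eqP ->].
    by rewrite negb_and next_color_neq orbT.
  - by exists c.
have [g gP] := fin_all_exists sepc.
exists (lst [ffun i => g i]).
  by apply: imset_f; apply/familyP => i; rewrite ffunE; case: (gP i).
move=> v; rewrite ffunE /= ffunE.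
have [gF [/subsetP /(_ v) Kg /subsetP /(_ v) Sg]] := gP (c0 v).
have [[cutF _] _] := FP (c0 v); have := @cut_disjoint _ _ v (cutF _ gF).
move: Kg Sg; rewrite !inE !eqxx /= => Kg Sg dis.
case: (color_cases (c0 v) (s v)) => sv.
- by rewrite sv; case: ifP; rewrite !inE eqxx.
- case: (boolP (v \in (g (c0 v)).1)) => [v1|_]; last by rewrite !inE sv eqxx orbT.
  by case: (dis v1 (Sg _)); rewrite sv.
- by rewrite Kg ?sv // !inE eqxx orbT.
Qed.

(** * Polynomial bounds and the equivalences *)

(** A value bounding a cardinality is nonnegative; as a natural number it can be multiplied and
    raised to powers monotonically. *)
Lemma horner_nat (P : {poly int}) (n k : nat) :
  (k%:Z <= P.[n%:Z])%R -> exists2 m : nat, (P.[n%:Z] = m%:Z)%R & k <= m.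
Proof.
by case: P.[n%:Z]%R => m le; [exists m; rewrite // -lez_nat | ].
Qed.

Theorem theorem26 :
  ((exists P : {poly int}, forall (G : sgraph) (L : G -> {set part}),
      exists F : {set {ffun G -> {set part}}},
        two_list_covering (maximal_stubborn_solution L) F /\
        (#|F|%:Z <= P.[#|G|%:Z])%R)
   <->
   (exists P : {poly int}, forall (n : nat) (f : 'I_n -> 'I_n -> color),
      edge_coloring f ->
      exists F : {set {ffun 'I_n -> {set color}}},
        two_list_covering (ccp_solution f) F /\
        (#|F|%:Z <= P.[n%:Z])%R))
  /\
  ((exists P : {poly int}, forall (n : nat) (f : 'I_n -> 'I_n -> color),
      edge_coloring f ->
      exists F : {set {ffun 'I_n -> {set color}}},
        two_list_covering (ccp_solution f) F /\
        (#|F|%:Z <= P.[n%:Z])%R)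
   <->
   (exists P : {poly int}, forall G : sgraph,
      exists F : {set {set G} * {set G}},
        CS_separator F /\
        (#|F|%:Z <= P.[#|G|%:Z])%R)).
Proof.
(* The factor [('X + 1) ^+ 2] accounts for the cuts produced by each list. *)
have sep_split (P : {poly int}) (n k k' : nat) :
    (k%:Z <= P.[n%:Z])%R -> k' <= k * n.+1 ^ 2 ->
    (k'%:Z <= (P * ('X + 1) ^+ 2).[n%:Z])%R.
  move=> /horner_nat [m Pm km] k'k.
  rewrite hornerM horner_exp hornerD hornerX hornerC Pm.
  rewrite -PoszD addn1 expr2 -!PoszM lez_nat mulnn.
  by apply: leq_trans k'k _; rewrite leq_mul2r km orbT.
have to3of1 : (exists P : {poly int}, forall (G : sgraph) (L : G -> {set part}),
      exists F : {set {ffun G -> {set part}}},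
        two_list_covering (maximal_stubborn_solution L) F /\
        (#|F|%:Z <= P.[#|G|%:Z])%R) ->
   (exists P : {poly int}, forall G : sgraph,
      exists F : {set {set G} * {set G}},
        CS_separator F /\
        (#|F|%:Z <= P.[#|G|%:Z])%R).
  move=> [P HP]; exists (P * ('X + 1) ^+ 2)%R => G.
  have [F [covF leF]] := HP G (fun=> [set A2; A3; A4]).
  have [F' [sepF' leF']] := separator_of_stubborn covF.
  by exists F'; split=> //; apply: sep_split leF leF'.
have to3of2 : (exists P : {poly int}, forall (n : nat) (f : 'I_n -> 'I_n -> color),
      edge_coloring f ->
      exists F : {set {ffun 'I_n -> {set color}}},
        two_list_covering (ccp_solution f) F /\
        (#|F|%:Z <= P.[n%:Z])%R) ->
   (exists P : {poly int}, forall G : sgraph,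
      exists F : {set {set G} * {set G}},
        CS_separator F /\
        (#|F|%:Z <= P.[#|G|%:Z])%R).
  move=> [P HP]; exists (P * ('X + 1) ^+ 2)%R => G.
  have [|F [covF leF]] := HP #|G| (fun u v =>
    if edge (enum_val u : G) (enum_val v) then ColA else ColB).
    by move=> u v; rewrite edge_sym.
  have [F' [sepF' leF']] := separator_of_ccp covF.
  by exists F'; split=> //; apply: sep_split leF leF'.
have to1of3 : (exists P : {poly int}, forall G : sgraph,
      exists F : {set {set G} * {set G}},
        CS_separator F /\
        (#|F|%:Z <= P.[#|G|%:Z])%R) ->
   (exists P : {poly int}, forall (G : sgraph) (L : G -> {set part}),
      exists F : {set {ffun G -> {set part}}},
        two_list_covering (maximal_stubborn_solution L) F /\
        (#|F|%:Z <= P.[#|G|%:Z])%R).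
  move=> [P HP]; exists (P ^+ 2)%R => G L; have [F [sepF leF]] := HP G.
  have [F' [covF' leF']] := stubborn_of_separator L sepF.
  exists F'; split=> //; have [m Pm Fm] := horner_nat leF.
  rewrite horner_exp Pm -!natz -natrX ler_nat.
  by apply: leq_trans leF' _; rewrite leq_exp2r.
have to2of3 : (exists P : {poly int}, forall G : sgraph,
      exists F : {set {set G} * {set G}},
        CS_separator F /\
        (#|F|%:Z <= P.[#|G|%:Z])%R) ->
   (exists P : {poly int}, forall (n : nat) (f : 'I_n -> 'I_n -> color),
      edge_coloring f ->
      exists F : {set {ffun 'I_n -> {set color}}},
        two_list_covering (ccp_solution f) F /\
        (#|F|%:Z <= P.[n%:Z])%R).
  move=> [P HP]; exists (P ^+ #|{: color}|)%R => n f fsym.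
  have sep i := HP (color_graph fsym i); rewrite /= card_ord in sep.
  (* The three color graphs have [n] vertices each, so the bound [m] read off from any one of them
     serves for all. *)
  have [F0 [_ /horner_nat [m Pm _]]] := sep ColA.
  have [|F [covF leF]] := @ccp_of_separator n f fsym m.
    by move=> i; have [F] := sep i; rewrite Pm lez_nat; exists F.
  by exists F; split=> //; rewrite horner_exp Pm -!natz -natrX ler_nat.
split; first by split=> [/to3of1/to2of3|/to3of2/to1of3].
by split=> [/to3of2|/to2of3].
Qed.
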